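(* Let $A,B,T\in B(\mathcal H)$ be operators such that $AT=TB$. If $T\in[DN]$ and at least one of the two conditions $BT=TA$ and $(A-B)T_d=T_d(B-A)$ is satisfied, then $T_d^*A=BT_d^*$ and $T_d^*B=AT_d^*$.
   Context: $\mathcal H$ is a complex infinite dimensional Hilbert space and $B(\mathcal H)$ is the algebra of bounded linear operators on $\mathcal H$; $[X,Y]=XY-YX$. An operator $T\in B(\mathcal H)$ is Drazin invertible if there is $T_d\in B(\mathcal H)$ (the Drazin inverse) with $[T_d,T]=0$, $T_d^2T=T_d$ and $T^{p+1}T_d=T^p$ for some integer $p\ge1$ (if $T$ is invertible, $T_d=T^{-1}$). $T\in[DN]$ (equivalently $T\in[(1,1)DN]$) means that $T$ is Drazin invertible and $[T_d,T^*]=0$. $T_d^*$ denotes the adjoint of $T_d$. *)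

(* Defs.v *)
From HB Require Import structures.
From mathcomp Require Import all_boot all_order all_algebra.
From mathcomp Require Import complex.
From mathcomp Require Import all_classical all_reals topology normedtype.
From mathcomp Require Import ring lra.

Set Implicit Arguments.
Unset Strict Implicit.
Unset Printing Implicit Defensive.

Import Order.TTheory GRing.Theory Num.Theory.
Import numFieldNormedType.Exports.

Local Open Scope classical_set_scope.
Local Open Scope ring_scope.
Local Open Scope complex_scope.

Section Drazin.
Variable A : pzRingType.

Definition commutator (x y : A) : A := x * y - y * x.

Definition is_drazin_inverse (t s : A) : Prop :=
  [/\ commutator s t = 0, s ^+ 2 * t = s
    & exists p : nat, (0 < p)%N /\ t ^+ p.+1 * s = t ^+ p].

Definition drazin_invertible (t : A) : Prop := exists s, is_drazin_inverse t s.

(* The Drazin inverse of [t]; it is [0] when [t] is not Drazin invertible. *)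
Definition drazin (t : A) : A := xget 0 [set s | is_drazin_inverse t s].

Lemma commutator_eq0 (x y : A) : commutator x y = 0 <-> GRing.comm x y.
Proof.
rewrite /commutator /GRing.comm.
by split=> [/eqP|->]; rewrite ?subrr// subr_eq0 => /eqP.
Qed.

Lemma drazin_inverse_uniq (t s s' : A) :
  is_drazin_inverse t s -> is_drazin_inverse t s' -> s = s'.
Proof.
move=> [/commutator_eq0 cs es [p [_ ep]]] [/commutator_eq0 cs' es' [q [_ eq]]].
have pow r (c : GRing.comm r t) m : t ^+ m.+1 * r = t ^+ m ->
    forall n k, (m <= n)%N -> t ^+ (n + k) * r ^+ k = t ^+ n.
  move=> e n k mn; elim: k => [|k IH]; first by rewrite addn0 expr0 mulr1.
  rewrite exprS mulrA -[RHS]IH; congr (_ * _).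
  have -> : (n + k.+1 = (n + k - m) + m.+1)%N.
    by rewrite !addnS subnK// (leq_trans mn)// leq_addr.
  by rewrite exprD -mulrA e -exprD subnK// (leq_trans mn)// leq_addr.
have sq r (c : GRing.comm r t) : r ^+ 2 * t = r ->
    forall k, r ^+ k.+1 * t ^+ k = r.
  move=> e; elim=> [|k IH]; first by rewrite expr0 mulr1 expr1.
  by rewrite exprS [t ^+ _]exprSr mulrA -(mulrA r) IH -expr2.
set n := maxn p q.
have Hs : s = s ^+ n.+1 * t ^+ (n + n.+1) * s' ^+ n.+1.
  by rewrite -mulrA (pow _ cs' _ eq) ?leq_maxr// sq.
have Hs' : s' = s ^+ n.+1 * t ^+ (n + n.+1) * s' ^+ n.+1.
  have -> : s ^+ n.+1 * t ^+ (n + n.+1) = t ^+ (n + n.+1) * s ^+ n.+1.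
    exact/commrX/commr_sym/commrX/commr_sym.
  rewrite (pow _ cs _ ep) ?leq_maxl//.
  have -> : t ^+ n * s' ^+ n.+1 = s' ^+ n.+1 * t ^+ n.
    exact/commrX/commr_sym/commrX.
  by rewrite sq.
by rewrite Hs -Hs'.
Qed.

Lemma drazinP (t : A) : drazin_invertible t -> is_drazin_inverse t (drazin t).
Proof. by move=> [s ts]; rewrite /drazin; case: xgetP => // /(_ s). Qed.

Lemma drazin_eq (t s : A) : is_drazin_inverse t s -> drazin t = s.
Proof.
by move=> ts; apply: drazin_inverse_uniq (ts); apply: drazinP; exists s.
Qed.

End Drazin.

HB.mixin Record CompleteNormedModule_isHilbert (R : realType) H
    of CompleteNormedModule R[i] H := {
  hdot : {dot H for @Num.conj R[i]};
  sqr_normE : forall x : H, `|x| ^+ 2 = hdot x x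
}.

#[short(type="hilbertType")]
HB.structure Definition Hilbert (R : realType) :=
  {H of CompleteNormedModule R[i] H & CompleteNormedModule_isHilbert R H}.

Definition finite_dim (K : fieldType) (V : lmodType K) : Prop :=
  exists (n : nat) (v : 'I_n -> V),
    forall x : V, exists c : 'I_n -> K, x = \sum_(i < n) c i *: v i.

Section BoundedOperators.
Variables (R : realType) (H : hilbertType R).

(* The norm of [H] takes its values in the nonnegative reals of [R[i]], hence
   [M : R[i]]. *)
Definition bounded_op : {pred H -> H} := fun f =>
  `[< linear f /\ exists M : R[i], forall x : H, `|f x| <= M * `|x| >].

Record bop := BOp { bop_fun :> H -> H ; _ : bop_fun \in bounded_op }.

HB.instance Definition _ := [isSub for bop_fun].
HB.instance Definition _ := [Choice of bop by <:].

Lemma bopP (f g : bop) : f =1 g <-> f = g.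
Proof. by split=> [/funext fg|->//]; exact/val_inj. Qed.

Fact bop_bound (f : bop) :
  exists2 M : R[i], 0 <= M & forall x : H, `|f x| <= M * `|x|.
Proof.
case: f => f /= /asboolP[_ [M fM]].
have [H0|/existsNP[x /eqP x0]] := pselect (forall x : H, x = 0).
  by exists 0 => // x; rewrite (H0 (f x)) normr0 mul0r.
exists M => //; rewrite -(@pmulr_lge0 _ `|x|) ?normr_gt0//.
exact: le_trans (fM x).
Qed.

Fact bounded_op_zmod_closed : zmod_closed bounded_op.
Proof.
split=> [|f g ff gg]; apply/asboolP.
  split=> [a x y|]; first by rewrite /= scaler0 addr0.
  by exists 0 => x; rewrite normr0 mul0r.
have [M M0 fM] := bop_bound (BOp ff); have [N N0 gN] := bop_bound (BOp gg).
have /asboolP[lf _] := ff; have /asboolP[lg _] := gg.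
split=> [a x y|].
  by rewrite /= !fctE lf lg scalerBr opprD addrACA.
exists (M + N) => x; rewrite mulrDl (le_trans (ler_normB _ _))//.
exact: lerD (fM x) (gN x).
Qed.

HB.instance Definition _ :=
  GRing.isZmodClosed.Build (H -> H) bounded_op bounded_op_zmod_closed.
HB.instance Definition _ := [SubChoice_isSubZmodule of bop by <:].

Fact bop_one_subproof : id \in bounded_op.
Proof. by apply/asboolP; split=> //; exists 1 => x; rewrite mul1r. Qed.

Fact bop_mul_subproof (f g : bop) : f \o g \in bounded_op.
Proof.
have [M M0 fM] := bop_bound f; have [N N0 gN] := bop_bound g.
case: f g fM gN => f /= /asboolP[lf _] [g /= /asboolP[lg _]] fM gN.
apply/asboolP; split=> [a x y|]; first by rewrite /= lg lf.
exists (M * N) => x; rewrite -mulrA (le_trans (fM _))//.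
exact: ler_wpM2l (gN x).
Qed.

Definition bop_one : bop := BOp bop_one_subproof.
Definition bop_mul (f g : bop) : bop := BOp (bop_mul_subproof f g).

Fact bop_mulA : associative bop_mul. Proof. by move=> f g h; exact/bopP. Qed.
Fact bop_mul1l : left_id bop_one bop_mul. Proof. by move=> f; exact/bopP. Qed.
Fact bop_mul1r : right_id bop_one bop_mul. Proof. by move=> f; exact/bopP. Qed.
Fact bop_mulDl : left_distributive bop_mul +%R.
Proof. by move=> f g h; exact/bopP. Qed.

Lemma bop_linear (f : bop) : linear f.
Proof. by case: f => f /= /asboolP[]. Qed.

HB.instance Definition _ (f : bop) :=
  GRing.isLinear.Build R[i] H H _ (bop_fun f) (bop_linear f).

Fact bop_mulDr : right_distributive bop_mul +%R.
Proof. by move=> f g h; apply/bopP => x /=; exact: linearD. Qed.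

HB.instance Definition _ := GRing.Zmodule_isPzRing.Build bop
  bop_mulA bop_mul1l bop_mul1r bop_mulDl bop_mulDr.

Lemma bop_mulE (f g : bop) x : (f * g) x = f (g x). Proof. by []. Qed.
Lemma bop_oneE x : (1 : bop) x = x. Proof. by []. Qed.
Lemma bop_zeroE x : (0 : bop) x = 0. Proof. by []. Qed.
Lemma bop_addE (f g : bop) x : (f + g) x = f x + g x. Proof. by []. Qed.
Lemma bop_oppE (f : bop) x : (- f) x = - f x. Proof. by []. Qed.

Definition is_adjoint (T S : bop) : Prop :=
  forall x y : H, hdot (T x) y = hdot x (S y).

End BoundedOperators.

Section Riesz.
Variables (R : realType) (H : hilbertType R).
Implicit Types (x y z : H).

Let hd (x y : H) : R[i] := hdot x y.

Let hdC x y : hd x y = (hd y x)^*%R.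
Proof. by rewrite /hd hermC expr0 mul1r. Qed.

Let hdDr x y z : hd x (y + z) = hd x y + hd x z.
Proof. exact: linearDr. Qed.
Let hdDl x y z : hd (x + y) z = hd x z + hd y z.
Proof. exact: linearDl. Qed.
Let hdZl a x y : hd (a *: x) y = a * hd x y.
Proof. exact: linearZl_LR. Qed.
Let hdZr a x y : hd x (a *: y) = a^*%R * hd x y.
Proof. exact: linearZr_LR. Qed.
Let hdBr x y z : hd x (y - z) = hd x y - hd x z.
Proof. exact: linearBr. Qed.
Let hdBl x y z : hd (x - y) z = hd x z - hd y z.
Proof. exact: linearBl. Qed.
Let hd0l y : hd 0 y = 0.
Proof. exact: linear0l. Qed.
Let hd0r y : hd y 0 = 0.
Proof. exact: linear0r. Qed.

Let hdxx x : hd x x = `|x| ^+ 2. Proof. by rewrite sqr_normE. Qed.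

Lemma hdot_ext x y : (forall z, hdot z x = hdot z y) -> x = y.
Proof.
move=> xy; apply/eqP; rewrite -subr_eq0 -normr_eq0 -sqrf_eq0 -hdxx hdBr.
by rewrite /hd xy subrr.
Qed.

Let hdBZ x y : y != 0 ->
  `|x - (hd x y / hd y y) *: y| ^+ 2 * `|y| ^+ 2
    = `|x| ^+ 2 * `|y| ^+ 2 - `|hd x y| ^+ 2.
Proof.
move=> y0; have ny : hd y y != 0 by rewrite hdxx sqrf_eq0 normr_eq0.
rewrite -!hdxx normCK hdBl !hdBr !hdZr !hdZl fmorph_div/= -(hdC y y) (hdC y x).
by field.
Qed.

Lemma hdot_CauchySchwarz x y : `|hdot x y| <= `|x| * `|y|.
Proof.
have [->|y0] := eqVneq y 0; first by rewrite -/(hd _ _) hd0r !normr0 mulr0.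
rewrite -(@ler_pXn2r _ 2)// ?nnegrE ?mulr_ge0// exprMn -subr_ge0 -hdBZ//.
by rewrite mulr_ge0// exprn_ge0.
Qed.

Let parallelogram x y :
  `|x - y| ^+ 2 + `|x + y| ^+ 2 = 2 * `|x| ^+ 2 + 2 * `|y| ^+ 2.
Proof. by rewrite -!hdxx hdBl hdDl !hdBr !hdDr; ring. Qed.

Let nr x : R := complex.Re `|x|.
Let nrE x : (nr x)%:C = `|x|.
Proof. by rewrite RRe_real// normr_real. Qed.
Let nr_ge0 x : 0 <= nr x. Proof. by rewrite -lecR nrE; exact: normr_ge0. Qed.

Lemma riesz (f : {scalar H}) (M : R[i]) :
  (forall x, `|f x| <= M * `|x|) -> exists z, forall x, f x = hdot x z.
Proof.
move=> fM.
have [f0|/existsNP[x0 /eqP fx0]] := pselect (forall x, f x = 0).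
  by exists 0 => x; rewrite f0 -/(hd _ _) hd0r.
pose D : set R := [set r | exists2 x, f x = 1 & nr x = r].
have D0 : D (nr ((f x0)^-1 *: x0)).
  by exists ((f x0)^-1 *: x0) => //; rewrite linearZ/= mulVf.
have hD : has_inf D.
  split; first by exists (nr ((f x0)^-1 *: x0)).
  by exists 0 => _ [x _ <-].
pose d := inf D.
have dmin x : f x = 1 -> d <= nr x.
  by move=> fx; apply: ge_inf; [case: hD | exists x].
have d0 : 0 <= d.
  apply: lb_le_inf; first by case: hD.
  by move=> _ [x _ <-].
pose S (e : R) : set H := [set x | f x = 1 /\ nr x < d + e].
have S0 e : 0 < e -> exists x, S e x.
  move=> e0; have [_ [x fx <-] xe] := inf_adherent e0 hD.
  by exists x.
pose F : set_system H := filter_from [set e : R | 0 < e] S.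
have FF : ProperFilter F.
  apply: filter_from_proper; last by move=> e /S0.
  apply: filter_from_filter; first by exists 1 => /=.
  move=> i j /= i0 j0; exists (Num.min i j); first by rewrite /= lt_min i0.
  move=> x [fx xij]; split; split=> //; apply: (lt_le_trans xij);
    by rewrite lerD2l ge_min lexx// orbT.
have close e x y : 0 < e -> e <= 1 -> S e x -> S e y ->
    nr (x - y) ^+ 2 <= (4 * (2 * d + 1)) * e.
  move=> e0 e1 [fx xe] [fy ye].
  have /dmin md : f (2^-1 *: (x + y)) = 1.
    by rewrite linearZ linearD/= fx fy; field.
  have nxy : nr (2^-1 *: (x + y)) = nr (x + y) / 2.
    apply: complexI; rewrite nrE normrZ rmorphM/= nrE mulrC ger0_norm ?invr_ge0//.
    by rewrite fmorphV/= rmorph_nat.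
  have := parallelogram x y; rewrite -!nrE -!rmorphXn/= => P.
  have {}P : nr (x - y) ^+ 2 + nr (x + y) ^+ 2 = 2 * nr x ^+ 2 + 2 * nr y ^+ 2.
    by apply: complexI; rewrite !rmorphD/= P !rmorphM/= !rmorph_nat.
  have := nr_ge0 x; have := nr_ge0 y; have := nr_ge0 (x + y).
  move: md; rewrite nxy.
  nra.
have Fc : cvg F.
  apply/cauchy_cvgP; apply/cauchy_exP => e e0.
  have e0' : 0 < complex.Re e.
    by rewrite -ltcR RRe_real// gtr0_real.
  set r := complex.Re e in e0'.
  pose k := 4 * (2 * d + 1); have k0 : 0 < k by rewrite /k mulr_gt0// ltr_wpDl// mulr_ge0.
  have kk0 : 0 < 2 * k by rewrite pmulr_rgt0.
  pose dl := Num.min 1 (r ^+ 2 / (2 * k)).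
  have dl0 : 0 < dl by rewrite lt_min ltr01 divr_gt0 ?exprn_gt0// mulr_gt0.
  have [x Sx] := S0 _ dl0; exists x; exists dl => // y Sy.
  have dl1 : dl <= 1 by rewrite ge_min lexx.
  have := close _ _ _ dl0 dl1 Sx Sy => xy.
  rewrite -ball_normE /ball_/= -nrE -[e]RRe_real ?gtr0_real// ltcR -/r.
  rewrite -(@ltr_pXn2r _ 2) ?nnegrE// ?(ltW e0')//.
  apply: (le_lt_trans xy); rewrite -/k; clearbody k.
  have : dl <= r ^+ 2 / (2 * k) by rewrite ge_min lexx orbT.
  rewrite (ler_pdivlMr _ _ kk0) => h.
  have : 0 < r ^+ 2 by rewrite exprn_gt0.
  nra.
have /cvg_ex[/= z Fz] := Fc.
have near_z e : 0 < e -> exists2 x, S e x & nr (z - x) < e.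
  move=> e0.
  have F1 : F (S e) by exists e.
  have F2 : F (ball z e%:C) by apply: Fz; apply: nbhsx_ballx; rewrite ltcR.
  have [x [Sx]] := filter_ex (filterI F1 F2).
  rewrite -ball_normE /ball_/= -nrE ltcR => zx.
  by exists x.
have fz : f z = 1.
  apply/eqP; rewrite -subr_eq0 -normr_eq0; apply/eqP/le_anti.
  rewrite normr_ge0 andbT.
  have nf : `|f z - 1| = (complex.Re `|f z - 1|)%:C.
    by rewrite RRe_real// normr_real.
  rewrite nf -[0]/(0%:C) lecR; apply/ler_addgt0Pr => e e0; rewrite add0r.
  pose N := Num.max 1 (complex.Re M).
  have N0 : 0 < N by rewrite lt_max ltr01.
  have [x [fx _] zx] := near_z _ (divr_gt0 e0 N0).
  have MR : (complex.Re M)%:C = M.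
    have : M \is Num.real.
      apply: (@ger0_real); rewrite -(@pmulr_lge0 _ `|x0|).
        exact: le_trans (fM x0).
      by rewrite normr_gt0; apply: contra_neq fx0 => ->; rewrite linear0.
    exact: RRe_real.
  rewrite -lecR -nf -fx -linearB (le_trans (fM _))// -MR -nrE -rmorphM lecR.
  move: zx; rewrite ltr_pdivlMr// => zx; rewrite mulrC.
  apply: le_trans (ltW zx); rewrite ler_wpM2l//.
  by rewrite le_max lexx orbT.
have zd : nr z <= d.
  apply/ler_addgt0Pr => e e0.
  have e2 : 0 < e / 2 by rewrite divr_gt0.
  have [x [_ xd] zx] := near_z _ e2.
  have : nr z <= nr x + nr (z - x).
    rewrite -lecR rmorphD/= !nrE addrC -{1}[z](subrK x).
    exact: ler_normD.
  lra.
have orth y : f y = 0 -> hd z y = 0.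
  move=> fy; have [->|y0] := eqVneq y 0; first by rewrite hd0r.
  have := dmin (z - (hd z y / hd y y) *: y).
  rewrite linearB/= linearZ/= fy mulr0 subr0 => /(_ fz) le.
  have E : `|hd z y| ^+ 2 =
      (`|z| ^+ 2 - `|z - (hd z y / hd y y) *: y| ^+ 2) * `|y| ^+ 2.
    by rewrite mulrBl hdBZ// subKr.
  apply/eqP; rewrite -normr_eq0 -sqrf_eq0; apply/eqP/le_anti.
  rewrite exprn_ge0 ?andbT// E mulr_le0_ge0 ?exprn_ge0// subr_le0.
  by rewrite lerXn2r ?nnegrE// -!nrE lecR (le_trans zd).
have z0 : z != 0.
  by apply/eqP => z0; move: fz; rewrite z0 linear0 => /esym/eqP; rewrite oner_eq0.
have nz : hd z z != 0 by rewrite hdxx sqrf_eq0 normr_eq0.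
exists ((hd z z)^-1 *: z) => x.
have := orth (x - f x *: z); rewrite linearB/= linearZ/= fz mulr1 subrr.
move=> /(_ erefl); rewrite hdC hdBl hdZl => /eqP.
rewrite conjC_eq0 subr_eq0 => /eqP xz.
by rewrite -/(hd _ _) hdZr xz fmorphV/= -hdC mulrCA mulVf ?mulr1.
Qed.

Lemma adjoint_ex (T : bop H) : exists S : bop H, is_adjoint T S.
Proof.
have [M M0 TM] := bop_bound T.
have /choice[S TS] : forall y, exists z, forall x, hdot (T x) y = hdot x z.
  move=> y.
  have lin : scalar (fun x => hdot (T x) y).
    by move=> a u v; rewrite linearP -!/(hd _ _) hdDl hdZl.
  pose f : {scalar H} := HB.pack (fun x => hdot (T x) y)
    (GRing.isLinear.Build _ _ _ _ (fun x => hdot (T x) y) lin).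
  have [|z fz] := @riesz f (M * `|y|); last by exists z => x; rewrite -fz.
  move=> x /=; rewrite (le_trans (hdot_CauchySchwarz _ _))// mulrAC.
  by rewrite ler_wpM2r.
have bS : S \in @bounded_op R H.
  apply/asboolP; split.
    move=> a u v; apply: hdot_ext => z.
    by rewrite -TS -!/(hd _ _) !hdDr !hdZr /hd -!TS.
  exists M => y; have [->|Sy0] := eqVneq (S y) 0.
    by rewrite normr0 mulr_ge0.
  have Sy : 0 < `|S y| by rewrite normr_gt0.
  rewrite -(ler_pM2r Sy) -expr2 -hdxx /hd -TS.
  have := hdot_CauchySchwarz (T (S y)) y.
  rewrite TS -/(hd _ _) hdxx ger0_norm ?exprn_ge0// => /le_trans; apply.
  by rewrite mulrAC ler_wpM2r.
by exists (BOp bS).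
Qed.

Definition adjoint (T : bop H) : bop H := sval (cid (adjoint_ex T)).

Lemma adjointP (T : bop H) x y : hdot (T x) y = hdot x (adjoint T y).
Proof. exact: (svalP (cid (adjoint_ex T))). Qed.

Lemma adjoint_eq (T S : bop H) : is_adjoint T S -> adjoint T = S.
Proof.
by move=> TS; apply/bopP => y; apply: hdot_ext => x; rewrite -adjointP TS.
Qed.

Definition DN (T : bop H) : Prop :=
  drazin_invertible T /\ commutator (drazin T) (adjoint T) = 0.

End Riesz.

(* Main.v *)
(* The intertwining relations pass from [T] to its Drazin inverse [S], namely
   [A S = S B] and [B S = S A]. Since [S] commutes with [T^*], it also commutes
   with [S^*]: [S] is normal. Then [S] intertwines [A + B] with itself and
   [A - B] with its opposite, and the Fuglede-Putnam theorem replaces [S] by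
   [S^*] in both relations.

   Fuglede-Putnam is proved without exponentials or Liouville's theorem. If
   [N X = X P] with [N] and [P] normal, consider, instead of
   [exp(z N^* ) X exp(- z P^* )], the operator polynomial
   [f(z) = (1 + z N^* / n)^n X (1 - z P^* / n)^n], whose coefficient of [z] is
   [N^* X - X P^*]. For [|z| = r] and [n] large, [|f(z)|] is bounded
   independently of [r], so Cauchy's estimate bounds [r |N^* X - X P^*|], and
   [r] is arbitrary. *)
Require Import Defs.
From mathcomp Require Import all_boot all_order all_algebra.
From mathcomp Require Import complex.
From mathcomp Require Import all_classical all_reals topology normedtype.
From mathcomp Require Import sequences exp zify ring lra.

Set Implicit Arguments.
Unset Strict Implicit.
Unset Printing Implicit Defensive.

Import Order.TTheory GRing.Theory Num.Theory.

Local Open Scope ring_scope.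

(** * Roots of unity and Cauchy's estimate *)

(** A [2 ^ k]-th root [w] of [-1] works: its order divides [2 ^ k.+1], and a smaller power of 2
    would force [w ^+ (2 ^ k) = 1]. *)
Lemma exists_prim_root_pow2 (C : numClosedFieldType) (k : nat) :
  exists w : C, (2 ^ k.+1)%N.-primitive_root w.
Proof.
have k0 : (0 < 2 ^ k)%N by rewrite expn_gt0.
pose w : C := (2 ^ k)%N.-root (-1).
have wk : w ^+ (2 ^ k) = -1 by exact: rootCK.
have wk1 : w ^+ (2 ^ k.+1) = 1 by rewrite expnSr exprM wk sqrrN expr1n.
exists w; have [|m pw] := prim_order_exists _ wk1; first by rewrite expn_gt0.
case/(dvdn_pfactor _ _ (isT : prime 2)) => j jk mE.
move: jk; rewrite leq_eqVlt => /predU1P[jk|jk]; first by rewrite -jk -mE.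
have : w ^+ (2 ^ k) == 1.
  by rewrite -(prim_order_dvd pw) mE dvdn_exp2l.
by rewrite wk -subr_eq0 -opprD oppr_eq0 (pnatr_eq0 C 2).
Qed.

Lemma sum_expr_unity_root (F : fieldType) (n : nat) (w : F) (k : nat) :
  n.-primitive_root w ->
  \sum_(i < n) (w ^+ i) ^+ k = if (n %| k)%N then n%:R else 0.
Proof.
move=> pw; rewrite (prim_order_dvd pw).
under eq_bigr do rewrite exprAC.
have [->|nz] := eqVneq (w ^+ k) 1.
  by under eq_bigr do rewrite expr1n; rewrite sumr_const card_ord.
apply: (@mulfI _ (w ^+ k - 1)); first by rewrite subr_eq0.
by rewrite -subrX1 mulr0 exprAC (prim_expr_order pw) expr1n subrr.
Qed.

Lemma norm_prim_root (C : numClosedFieldType) (n : nat) (w : C) :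
  n.-primitive_root w -> `|w| = 1.
Proof.
move=> pw; have n0 := prim_order_gt0 pw.
apply/eqP; rewrite -(@pexpr_eq1 _ _ n)// -normrX (prim_expr_order pw).
by rewrite normr1.
Qed.

(* Cauchy's estimate; averaging over roots of unity replaces the contour
   integral. *)
Lemma cauchy_estimate (C : numClosedFieldType) (V : normedModType C)
    (I : finType) (d : I -> nat) (c : I -> V) (r b : C) :
  0 <= r ->
  (forall z : C, `|z| = r -> `|\sum_i z ^+ d i *: c i| <= b) ->
  r * `|\sum_(i | d i == 1%N) c i| <= b.
Proof.
move=> r0 bd.
pose D := (\max_i d i)%N; pose n := (2 ^ D.+1)%N.
have dn i : (d i < n.-1)%N.
  have : (d i <= D)%N by rewrite /D (leq_bigmax i).
  by have := ltn_expl D.+1 (isT : (1 < 2)%N); rewrite -/n; lia.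
have [w pw] := @exists_prim_root_pow2 C D; rewrite -/n in pw.
have nw := norm_prim_root pw.
have nn0 : 0 < n%:R :> C by rewrite ltr0n expn_gt0.
(* The weight [(w ^+ k) ^+ n.-1] is the inverse of [w ^+ k] and selects degree 1: since
   [d i < n.-1], no other degree makes [n.-1 + d i] a multiple of [n]. *)
have E : \sum_(k < n) (w ^+ k) ^+ n.-1 *: (\sum_i (r * w ^+ k) ^+ d i *: c i)
    = (n%:R * r) *: \sum_(i | d i == 1%N) c i.
  under eq_bigr do rewrite scaler_sumr.
  rewrite exchange_big/= scaler_sumr [RHS]big_mkcond/=; apply: eq_bigr => i _.
  under eq_bigr do rewrite scalerA exprMn mulrCA -exprD.
  rewrite -scaler_suml -mulr_sumr (sum_expr_unity_root _ pw).
  have -> : (n %| n.-1 + d i)%N = (d i == 1%N).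
    have di := dn i; have n1 : (0 < n)%N by rewrite expn_gt0.
    apply/idP/eqP => [/dvdnP[j]|->]; last by rewrite addn1 prednK.
    by case: j => [|[|j]]; nia.
  by case: eqP => [->|_]; [rewrite expr1 mulrC | rewrite mulr0 scale0r].
rewrite -(ler_pM2l nn0) mulrA -[X in X * _]ger0_norm ?mulr_ge0 ?ler0n//.
rewrite -normrZ -E (le_trans (ler_norm_sum _ _ _))//.
rewrite mulr_natl -[n in leRHS]card_ord -sumr_const ler_sum// => k _.
rewrite normrZ !normrX nw !expr1n mul1r bd// normrM normrX nw expr1n mulr1.
exact: ger0_norm.
Qed.

(** * Exponential estimates over the reals *)

Lemma exprD1_le_expR (R : realType) (u : R) n :
  0 <= u -> (1 + u) ^+ n <= expR (n%:R * u).
Proof.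
move=> u0; rewrite expRM_natl lerXn2r ?nnegrE ?expR_ge0 ?addr_ge0//.
exact: expR_ge1Dx.
Qed.

(** With [t = a ^+ 2 / n%:R], the two kinds of powers are at most [expR t] and [expR a], and
    [expR t - 1 <= t * expR t]. The lower bound on [n] gives [t * expR (2 * a) <= 1], which removes
    [a] from the result. *)
Lemma conjugate_bound_le (R : realType) (a b e : R) (n : nat) :
  0 <= a -> 0 <= b -> (0 < n)%N -> a ^+ 2 * expR (2 * a) <= n%:R ->
  e = a / n%:R ->
  (1 + e ^+ 2) ^+ n * b * (1 + e ^+ 2) ^+ n
     + (1 + e) ^+ n * b * (1 + e) ^+ n * ((1 + e ^+ 2) ^+ n - 1)
  <= b * (expR 1 * expR 1 + expR 1).
Proof.
move=> a0 b0 n0 an eE.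
have n0R : 0 < n%:R :> R by rewrite ltr0n.
have e0 : 0 <= e by rewrite eE divr_ge0// ltW.
set D := (1 + e ^+ 2) ^+ n; set E := (1 + e) ^+ n.
have D1 : 1 <= D by rewrite exprn_ege1// lerDl sqr_ge0.
have E0 : 0 <= E by rewrite exprn_ge0// addr_ge0.
pose t := a ^+ 2 / n%:R.
have t0 : 0 <= t by rewrite divr_ge0 ?sqr_ge0// ltW.
have ta : t * expR (2 * a) <= 1 by rewrite mulrAC ler_pdivrMr// mul1r.
have Ea : E * E <= expR (2 * a).
  have Ee : E <= expR a.
    rewrite (le_trans (exprD1_le_expR n e0))// ler_expR.
    by rewrite eE mulrC divfK// gt_eqF.
  have -> : expR (2 * a) = expR a * expR a by rewrite -expRD; congr expR; lra.
  exact: ler_pM.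
have ea1 : 1 <= expR (2 * a).
  by apply: le_trans (expR_ge1Dx _); rewrite lerDl mulr_ge0.
have t1 : t <= 1 by apply: le_trans ta; rewrite ler_peMr.
have De : D <= expR t.
  rewrite (le_trans (exprD1_le_expR n (sqr_ge0 _)))// ler_expR.
  have -> : n%:R * e ^+ 2 = t; last by [].
  by rewrite /t eE; field; rewrite gt_eqF.
have tt : expR t <= expR 1 by rewrite ler_expR.
have et : expR t - 1 <= t * expR t.
  have := expR_ge1Dx (- t); rewrite expRN => h.
  have p := expR_gt0 t.
  have : (1 - t) * expR t <= 1 by rewrite -ler_pdivlMr// div1r.
  lra.
have D2 : D * D <= expR 1 * expR 1.
  by apply: ler_pM; lra.
have EE : E * E * (D - 1) <= expR 1.
  have h : D - 1 <= t * expR 1.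
    have : t * expR t <= t * expR 1 by rewrite ler_wpM2l.
    lra.
  have : E * E * (D - 1) <= expR (2 * a) * (t * expR 1).
    by apply: ler_pM => //; [rewrite mulr_ge0|lra].
  have : t * expR (2 * a) * expR 1 <= 1 * expR 1.
    by rewrite ler_wpM2r// expR_ge0.
  have -> : expR (2 * a) * (t * expR 1) = t * expR (2 * a) * expR 1 by ring.
  lra.
have -> : D * b * D + E * b * E * (D - 1) = b * (D * D + E * E * (D - 1)) by ring.
by rewrite ler_wpM2l// lerD.
Qed.

(** * Scalars, adjoints and norm bounds for operators *)

Section OperatorNorm.
Local Open Scope complex_scope.
Variables (R : realType) (H : hilbertType R).
Implicit Types (F G N P Q T U V X : bop H) (x y : H) (a b c e r : R) (z : R[i]).

Lemma bop_sumE (I : finType) (f : I -> bop H) x : (\sum_i f i) x = \sum_i f i x.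
Proof. by elim/big_rec2: _ => // i y G _ <-. Qed.

Lemma bop_mulrnE F n x : (F *+ n) x = F x *+ n.
Proof. by elim: n => [|n IH]; rewrite ?mulr0n// !mulrS bop_addE IH. Qed.

Fact scalar_bop_subproof z : (fun x : H => z *: x) \in @bounded_op R H.
Proof.
apply/asboolP; split=> [a x y|]; last by exists `|z| => x; rewrite normrZ.
by rewrite scalerDr !scalerA mulrC.
Qed.

Definition scalar_bop z : bop H := BOp (scalar_bop_subproof z).

Lemma scalar_bopE z x : scalar_bop z x = z *: x. Proof. by []. Qed.

Lemma scalar_bopC z F : GRing.comm (scalar_bop z) F.
Proof. by apply/bopP => x; rewrite !bop_mulE !scalar_bopE linearZ. Qed.

Lemma mulr_scalar_bop z F G : F * (scalar_bop z * G) = scalar_bop z * (F * G).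
Proof. by rewrite mulrA -scalar_bopC mulrA. Qed.

Lemma scalar_bop_exp z F n x : ((scalar_bop z * F) ^+ n) x = z ^+ n *: (F ^+ n) x.
Proof.
elim: n => [|n IH]; first by rewrite !expr0 scale1r.
by rewrite !exprS !bop_mulE scalar_bopE IH linearZ/= scalerA.
Qed.

Lemma is_adjoint_sym T U : is_adjoint T U -> is_adjoint U T.
Proof.
have hC (u v : H) : hdot u v = (hdot v u)^*%R by rewrite hermC expr0 mul1r.
by move=> TU x y; rewrite hC -TU -hC.
Qed.

Lemma is_adjointD T T' U U' :
  is_adjoint T U -> is_adjoint T' U' -> is_adjoint (T + T') (U + U').
Proof.
move=> TU TU' x y; rewrite !bop_addE.
by transitivity (hdot (T x) y + hdot (T' x) y);
  [exact: linearDl | rewrite TU TU'; symmetry; exact: linearDr].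
Qed.

Lemma is_adjointN T U : is_adjoint T U -> is_adjoint (- T) (- U).
Proof.
move=> TU x y; rewrite !bop_oppE.
by transitivity (- hdot (T x) y);
  [exact: linearNl | rewrite TU; symmetry; exact: linearNr].
Qed.

Lemma is_adjointM T T' U U' :
  is_adjoint T U -> is_adjoint T' U' -> is_adjoint (T * T') (U' * U).
Proof. by move=> TU TU' x y; rewrite !bop_mulE TU TU'. Qed.

Lemma is_adjointZ z T U :
  is_adjoint T U -> is_adjoint (scalar_bop z * T) (scalar_bop (z^*)%R * U).
Proof.
move=> TU x y; rewrite !bop_mulE !scalar_bopE.
transitivity (z * hdot (T x) y); first exact: linearZl_LR.
rewrite TU -[z in LHS]conjCK; symmetry; exact: linearZr_LR.
Qed.

Lemma is_adjoint_adjoint T : is_adjoint T (adjoint T).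
Proof. exact: adjointP. Qed.

(** A bound on the operator norm, kept as a relation so that no supremum is taken; [c] is real
    although norms live in [R[i]]. *)
Definition opnorm_le F c := forall x, `|F x| <= c%:C * `|x|.

Lemma opnorm_le_ex F : exists2 c, 0 <= c & opnorm_le F c.
Proof.
have [M M0 FM] := bop_bound F; exists (complex.Re M).
  by rewrite -lecR RRe_real// ger0_real.
by move=> x; rewrite RRe_real ?ger0_real.
Qed.

Lemma opnorm_leW F c c' : c <= c' -> opnorm_le F c -> opnorm_le F c'.
Proof. by move=> cc Fc x; rewrite (le_trans (Fc x))// ler_wpM2r// lecR. Qed.

Lemma opnorm_le1 : opnorm_le 1 1.
Proof. by move=> x; rewrite mul1r. Qed.

Lemma opnorm_leD F G c c' :
  opnorm_le F c -> opnorm_le G c' -> opnorm_le (F + G) (c + c').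
Proof.
move=> Fc Gc x; rewrite bop_addE (le_trans (ler_normD _ _))// rmorphD/= mulrDl.
exact: lerD.
Qed.

Lemma opnorm_leN F c : opnorm_le F c -> opnorm_le (- F) c.
Proof. by move=> Fc x; rewrite bop_oppE normrN. Qed.

Lemma opnorm_leM F G c c' : 0 <= c ->
  opnorm_le F c -> opnorm_le G c' -> opnorm_le (F * G) (c * c').
Proof.
move=> c0 Fc Gc x; rewrite bop_mulE (le_trans (Fc _))// rmorphM/= -mulrA.
by rewrite ler_wpM2l// lecR.
Qed.

Lemma opnorm_leX F c n : 0 <= c -> opnorm_le F c -> opnorm_le (F ^+ n) (c ^+ n).
Proof.
move=> c0 Fc; elim: n => [|n IH]; first exact: opnorm_le1.
by rewrite !exprS; apply: opnorm_leM.
Qed.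

Lemma opnorm_leZ z F r c : `|z| = r%:C ->
  opnorm_le F c -> opnorm_le (scalar_bop z * F) (r * c).
Proof.
move=> zr Fc x; rewrite bop_mulE scalar_bopE normrZ zr rmorphM/= -mulrA.
by rewrite ler_wpM2l// -zr.
Qed.

(** One more factor adds [F * (1 - F) ^+ n], of norm at most [e * (1 + e) ^+ n], exactly the
    increment of the bound. *)
Lemma opnorm_le_1BX F e n : 0 <= e -> opnorm_le F e ->
  opnorm_le (1 - (1 - F) ^+ n) ((1 + e) ^+ n - 1).
Proof.
move=> e0 Fe; elim: n => [|n IH].
  by rewrite !expr0 !subrr => x; rewrite bop_zeroE normr0 mul0r.
have -> : 1 - (1 - F) ^+ n.+1 = (1 - (1 - F) ^+ n) + F * (1 - F) ^+ n.
  by rewrite exprS -[RHS]addrA; congr (1 + _); rewrite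
    mulrBl mul1r opprB addrC.
have -> : (1 + e) ^+ n.+1 - 1 = ((1 + e) ^+ n - 1) + e * (1 + e) ^+ n.
  by rewrite exprS; lra.
apply: opnorm_leD => //; apply: opnorm_leM => //; apply: opnorm_leX.
  by rewrite addr_ge0.
by apply: opnorm_leD; [exact: opnorm_le1 | exact: opnorm_leN].
Qed.

(* [(1 + U) (1 - U')] has the same norm at [x] as [1 - U' ^+ 2]: compare the
   squares. *)
Lemma opnorm_le_cayley U U' e : 0 <= e ->
  is_adjoint U U' -> GRing.comm U U' -> opnorm_le U' e ->
  opnorm_le ((1 + U) * (1 - U')) (1 + e ^+ 2).
Proof.
move=> e0 UU' cU Ue.
set Q := (1 + U) * (1 - U'); set W := 1 - U' ^+ 2.
have U'U := is_adjoint_sym UU'.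
have QQ : is_adjoint Q ((1 - U) * (1 + U')).
  by apply: is_adjointM; apply: is_adjointD => //; exact: is_adjointN.
have WW : is_adjoint W (1 - U ^+ 2).
  apply: is_adjointD => //; apply: is_adjointN.
  by rewrite !expr2; apply: is_adjointM.
(* Once [1 - U ^+ 2] and [W] are factored, the two sides differ by an exchange of the middle factors
   [1 + U'] and [1 + U]. *)
have E : (1 - U) * (1 + U') * Q = (1 - U ^+ 2) * W.
  have cP : GRing.comm (1 + U') (1 + U).
    by apply: commrD; [exact: commr1|apply/commr_sym/commrD => //; exact: commr1].
  have fac (F : bop H) : 1 - F ^+ 2 = (1 - F) * (1 + F).
    by rewrite mulrDr mulr1 mulrBl mul1r -expr2 addrA subrK.
  by rewrite /W -(sqrrN U') !fac opprK /Q !mulrA -(mulrA _ (1 + U')) cP !mulrA.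
have QW x : `|Q x| = `|W x|.
  apply/eqP; rewrite -(@eqrXn2 _ 2)//; apply/eqP.
  by rewrite !sqr_normE QQ WW -!bop_mulE E.
move=> x; rewrite QW.
have : opnorm_le W (1 + e ^+ 2).
  apply: opnorm_leD; [exact: opnorm_le1|apply: opnorm_leN].
  exact: opnorm_leX.
exact.
Qed.

(* Multiplying on the right by [D := (1 - V' ^+ 2) ^+ n], which is close to [1],
   turns the operator into a product of [X] and powers of Cayley-like factors
   [(1 + U) (1 - U')] and [(1 + V) (1 - V')]; the second summand of the bound
   pays for replacing [D] by [1]. *)
Lemma opnorm_le_conjugate U U' V V' X b e n : 0 <= b -> 0 <= e ->
  is_adjoint U U' -> GRing.comm U U' -> opnorm_le U e -> opnorm_le U' e ->
  is_adjoint V V' -> GRing.comm V V' -> opnorm_le V e -> opnorm_le V' e ->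
  opnorm_le X b -> U' * X = - (X * V') ->
  opnorm_le ((1 + U) ^+ n * X * (1 + V) ^+ n)
    ((1 + e ^+ 2) ^+ n * b * (1 + e ^+ 2) ^+ n
     + (1 + e) ^+ n * b * (1 + e) ^+ n * ((1 + e ^+ 2) ^+ n - 1)).
Proof.
move=> b0 e0 UU' cU Ue U'e VV' cV Ve V'e Xb UX.
set F := (X in opnorm_le X); pose D := (1 - V' ^+ 2) ^+ n.
have e20 : 0 <= 1 + e ^+ 2 by rewrite addr_ge0// sqr_ge0.
have e10 : 0 <= 1 + e by rewrite addr_ge0.
have c1V W : GRing.comm V' W -> GRing.comm (1 + V') W.
  by move=> c; apply/commr_sym/commrD; [exact: commr1|exact/commr_sym].
have c2V W : GRing.comm V' W -> GRing.comm (1 - V') W.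
  by move=> c; apply/commr_sym/commrB; [exact: commr1|exact/commr_sym].
have cp : GRing.comm (1 + V') (1 - V').
  by apply: c1V; apply: commrB; [exact: commr1|].
have cq : GRing.comm (1 + V') (1 + V).
  by apply: c1V; apply: commrD; [exact: commr1|exact/commr_sym].
have cr : GRing.comm (1 + V) (1 - V').
  by apply/commr_sym/c2V/commrD; [exact: commr1|exact/commr_sym].
have cs : GRing.comm (1 + U) (1 - U').
  apply: commrB; first exact: commr1.
  by apply/commr_sym/commrD; [exact: commr1|exact/commr_sym].
have XV : X * (1 + V') ^+ n = (1 - U') ^+ n * X.
  elim: (n) => [|k IH]; first by rewrite !expr0 mulr1 mul1r.
  rewrite exprSr mulrA IH -mulrA mulrDr mulr1 -[X * V']opprK -UX.
  by rewrite -{1}[X]mul1r -mulrBl mulrA -exprSr.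
have DE : D = (1 + V') ^+ n * (1 - V') ^+ n.
  rewrite -exprMn_comm//; congr (_ ^+ n).
  by rewrite mulrBr mulr1 mulrDl mul1r -expr2 opprD addrA addrK.
(* The factor [(1 + V') ^+ n] of [D] crosses [(1 + V) ^+ n] and then [X], where [XV] turns it into
   [(1 - U') ^+ n]; the factor [(1 - V') ^+ n] stays on the right. *)
have FD : F * D = ((1 + U) * (1 - U')) ^+ n * X * ((1 + V) * (1 - V')) ^+ n.
  rewrite !exprMn_comm// -(mulrA _ _ X) -XV DE /F.
  have cqn : (1 + V) ^+ n * (1 + V') ^+ n = (1 + V') ^+ n * (1 + V) ^+ n.
    exact/commrX/commr_sym/commrX.
  by rewrite mulrA -(mulrA _ ((1 + V) ^+ n)) cqn !mulrA.
have -> : F = F * D + F * (1 - D) by rewrite -mulrDr addrC subrK mulr1.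
apply: opnorm_leD.
  rewrite FD; apply: opnorm_leM; first by rewrite mulr_ge0// exprn_ge0.
    apply: opnorm_leM => //; first by rewrite exprn_ge0.
    by apply: opnorm_leX => //; apply: opnorm_le_cayley.
  by apply: opnorm_leX => //; apply: opnorm_le_cayley.
have U1 T : opnorm_le T e -> opnorm_le ((1 + T) ^+ n) ((1 + e) ^+ n).
  by move=> Te; apply: opnorm_leX => //; apply: opnorm_leD => //; exact: opnorm_le1.
apply: opnorm_leM; first by rewrite !mulr_ge0// exprn_ge0.
  apply: opnorm_leM; [by rewrite mulr_ge0// exprn_ge0| |exact: U1].
  by apply: opnorm_leM => //; [rewrite exprn_ge0|exact: U1].
by apply: opnorm_le_1BX; [rewrite sqr_ge0|apply: opnorm_leX].
Qed.

(** Cauchy's estimate at each vector [x]: both binomials are expanded, the terms are indexed by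
    pairs of exponents, and the pairs [(1, 0)] and [(0, 1)] give the coefficient of [z]. *)
Lemma opnorm_le_derivation P Q X n r c : 0 < r ->
  (forall z, `|z| = r%:C -> opnorm_le
    ((1 + scalar_bop z * P) ^+ n.+1 * X * (1 + scalar_bop z * Q) ^+ n.+1) c) ->
  forall x, r%:C * `|((P * X + X * Q) *+ n.+1) x| <= c%:C * `|x|.
Proof.
move=> r0 Fc x.
pose I : finType := ('I_n.+2 * 'I_n.+2)%type.
pose d (p : I) := (p.1 + p.2)%N.
pose w (p : I) : H :=
  (P ^+ p.1 * X * Q ^+ p.2) x *+ ('C(n.+1, p.1) * 'C(n.+1, p.2)).
have -> : ((P * X + X * Q) *+ n.+1) x = \sum_(p | d p == 1%N) w p.
  rewrite (bigD1 (lift ord0 ord0, ord0))//= (bigD1 (ord0, lift ord0 ord0))//=.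
  rewrite big1 ?addr0; last first.
    case=> -[[|[|i]] ?] [[|[|j]] ?]//=.
  by rewrite /w/= !bin0 !bin1 muln1 mul1n -mulrnDl bop_mulrnE.
apply: cauchy_estimate; first by rewrite lecR ltW.
move=> z zr; have := Fc z zr x; congr (`|_| <= _).
rewrite ![1 + _]addrC !exprD1n !mulr_suml bop_sumE.
rewrite -(pair_bigA _ (fun i j => z ^+ d (i, j) *: w (i, j)))/=.
apply: eq_bigr => i _; rewrite bop_sumE !linear_sum; apply: eq_bigr => j _.
rewrite !bop_mulrnE scalar_bop_exp !linearMn !linearZ/= bop_mulrnE.
by rewrite scalar_bop_exp !scalerMnr scalerA mulrC -exprD mulrnA.
Qed.

End OperatorNorm.

Arguments scalar_bop {R H} z.

(** * The Fuglede-Putnam theorem *)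

Section FugledePutnam.
Local Open Scope complex_scope.
Variables (R : realType) (H : hilbertType R).
Implicit Types (F N P Q X : bop H) (x : H) (r c : R).

Lemma bop_mulr2n_inj (F G : bop H) : F *+ 2 = G *+ 2 -> F = G.
Proof.
move=> FG; apply/bopP => x.
apply: (@scalerI _ _ (2 : R[i])); first by rewrite pnatr_eq0.
by rewrite !scaler_nat -!bop_mulrnE FG.
Qed.

Lemma bop_eq0_scaled_bound F c : 0 <= c ->
  (forall r, 0 < r -> forall x, r%:C * `|F x| <= c%:C * `|x|) -> F = 0.
Proof.
move=> c0 Fc; apply/bopP => x; rewrite bop_zeroE; apply/eqP; rewrite -normr_eq0.
have nE (y : H) : `|y| = (complex.Re `|y|)%:C by rewrite RRe_real// normr_real.
have y0 : 0 <= complex.Re `|F x| by rewrite -lecR -nE normr_ge0.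
have x0 : 0 <= complex.Re `|x| by rewrite -lecR -nE normr_ge0.
have [u uE] : exists u, `|F x| = u%:C by exists (complex.Re `|F x|).
have [v vE] : exists v, `|x| = v%:C by exists (complex.Re `|x|).
move: y0 x0; rewrite uE vE/= le_eqVlt => /predU1P[<- _|u0 v0]; first exact: eqxx.
(* At this radius the hypothesis reads [c * v + 1 <= c * v]. *)
have rp : 0 < (c * v + 1) / u by rewrite divr_gt0// ltr_wpDl// mulr_ge0.
have := Fc _ rp x; rewrite uE vE -!rmorphM lecR/= divfK ?gt_eqF//.
  by rewrite gerDl ler10.
by rewrite ltcR.
Qed.

(** Two normal operators are allowed so that [P] can be [- N], as the relation for [A - B]
    requires. *)
Lemma fuglede_putnam N N' P P' X :
  is_adjoint N N' -> GRing.comm N N' -> is_adjoint P P' -> GRing.comm P P' ->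
  N * X = X * P -> N' * X = X * P'.
Proof.
move=> NN cN PP cP NX; apply/eqP; rewrite -subr_eq0; apply/eqP.
have [M1 M10 NM] := opnorm_le_ex N; have [M2 M20 N'M] := opnorm_le_ex N'.
have [M3 M30 PM] := opnorm_le_ex P; have [M4 M40 P'M] := opnorm_le_ex P'.
have [b b0 Xb] := opnorm_le_ex X.
pose M := M1 + M2 + M3 + M4.
have M0 : 0 <= M by rewrite !addr_ge0.
have {}NM : opnorm_le N M by apply: opnorm_leW NM; rewrite /M; lra.
have {}N'M : opnorm_le N' M by apply: opnorm_leW N'M; rewrite /M; lra.
have {}PM : opnorm_le P M by apply: opnorm_leW PM; rewrite /M; lra.
have {}P'M : opnorm_le P' M by apply: opnorm_leW P'M; rewrite /M; lra.
apply: (@bop_eq0_scaled_bound _ (b * (expR 1 * expR 1 + expR 1))).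
  by rewrite mulr_ge0// addr_ge0 ?mulr_ge0 ?expR_ge0.
move=> r r0 x.
pose a := r * M; have a0 : 0 <= a by rewrite mulr_ge0// ltW.
(* The degree [n.+1] is chosen after [r], as [conjugate_bound_le] demands; [s] below is its
   inverse. *)
pose n := Num.bound (a ^+ 2 * expR (2 * a)).
have an : a ^+ 2 * expR (2 * a) <= n.+1%:R.
  rewrite (le_trans (ltW (archi_boundP _)))// ?ler_nat//.
  by rewrite mulr_ge0 ?expR_ge0// sqr_ge0.
pose s : R[i] := (n.+1%:R^-1)%:C.
have sn : s *+ n.+1 = 1.
  rewrite -mulr_natr /s -(rmorph_nat (real_complex R)) -rmorphM/=.
  by rewrite mulVf ?pnatr_eq0.
have -> : N' * X - X * P'
    = (scalar_bop s * N' * X + X * (scalar_bop s * - P')) *+ n.+1.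
  have mulns F : (scalar_bop s * F) *+ n.+1 = F.
    apply/bopP => y; rewrite bop_mulrnE bop_mulE scalar_bopE scalerMnl.
    by rewrite sn scale1r.
  by rewrite -mulrA mulr_scalar_bop -mulrDr mulns mulrN.
apply: opnorm_le_derivation => // z zr.
have cb := conjugate_bound_le a0 b0 (ltn0Sn n) an erefl.
apply: opnorm_leW cb _.
have zr' : `|z^*%R| = r%:C by rewrite norm_conjC.
have sr : `|s| = (n.+1%:R^-1)%:C by rewrite ger0_norm// lecR invr_ge0.
have sr' : `|s^*%R| = (n.+1%:R^-1)%:C by rewrite norm_conjC.
have bd w w' F : `|w| = r%:C -> `|w'| = (n.+1%:R^-1)%:C -> opnorm_le F M ->
    opnorm_le (scalar_bop w * (scalar_bop w' * F)) (a / n.+1%:R).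
  move=> wr wr' FM; have -> : a / n.+1%:R = r * (n.+1%:R^-1 * M).
    by rewrite /a -mulrA (mulrC M).
  by apply: opnorm_leZ => //; apply: opnorm_leZ.
have cm w w' v v' F G : GRing.comm F G ->
    GRing.comm (scalar_bop w * (scalar_bop w' * F))
      (scalar_bop v * (scalar_bop v' * G)).
  move=> c; apply: commrM; first exact/commr_sym/scalar_bopC.
  apply: commrM; first exact/commr_sym/scalar_bopC.
  apply/commr_sym/commrM; first exact/commr_sym/scalar_bopC.
  by apply: commrM; [exact/commr_sym/scalar_bopC|exact/commr_sym].
(* Here [U] and [V] are the multiples of [N'] and [- P'] by [z * s], so their adjoints involve [N]
   and [- P], and the condition [U' * X = - (X * V')] comes from [N * X = X * P]. *)
apply: (@opnorm_le_conjugate _ _ _ (scalar_bop z^*%R * (scalar_bop s^*%R * N))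
  _ (scalar_bop z^*%R * (scalar_bop s^*%R * - P))) => //.
- by rewrite divr_ge0.
- by apply/is_adjointZ/is_adjointZ/is_adjoint_sym.
- exact/cm/commr_sym.
- exact: bd.
- exact: bd.
- by apply/is_adjointZ/is_adjointZ/is_adjointN/is_adjoint_sym.
- by apply/cm/commrN/commr_sym/commrN.
- by apply: bd => //; apply: opnorm_leN.
- by apply: bd => //; apply: opnorm_leN.
- by rewrite -!mulrA NX !(mulr_scalar_bop _ X) !mulrN opprK.
Qed.

End FugledePutnam.

(** * Intertwining relations for Drazin inverses *)

(** Both sides equal [s' * x * t * s]. For the first, write [s = t ^+ q * s ^+ q.+1] with the
    exponent [q] of [t']: carried across [x], [t ^+ q] becomes [t' ^+ q = t' ^+ q.+1 * s']. The
    second is symmetric. *)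
Lemma drazin_intertwine (A : pzRingType) (t s x t' s' : A) :
  is_drazin_inverse t s -> is_drazin_inverse t' s' ->
  x * t = t' * x -> x * s = s' * x.
Proof.
move=> [/commutator_eq0 c e [p [_ ep]]] [/commutator_eq0 c' e' [q [_ eq]]] xt.
have xtn n : x * t ^+ n = t' ^+ n * x.
  elim: n => [|n IH]; first by rewrite !expr0 mulr1 mul1r.
  by rewrite exprSr mulrA IH -mulrA xt mulrA -exprSr.
have sq (u r : A) (uu : GRing.comm r u) : r ^+ 2 * u = r ->
    forall k, r ^+ k.+1 * u ^+ k = r.
  move=> er; elim=> [|k IH]; first by rewrite expr0 mulr1 expr1.
  by rewrite exprS [u ^+ _]exprSr mulrA -(mulrA r) IH -expr2.
have xs : x * s = s' * x * t * s.
  have tsC m n : t ^+ m * s ^+ n = s ^+ n * t ^+ m.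
    exact/commr_sym/commrX/commr_sym/commrX.
  rewrite -[in LHS](sq _ _ c e q) -tsC mulrA xtn -eq.
  have -> : t' ^+ q.+1 * s' = s' * t' ^+ q.+1 by apply/commr_sym/commrX.
  rewrite -(mulrA s') -xtn -!mulrA tsC [t ^+ _]exprSr.
  rewrite (mulrA _ (t ^+ q)) (sq _ _ c e).
  by rewrite -c.
have sx : s' * x = s' * x * t * s.
  rewrite -[in LHS](sq _ _ c' e' p) -mulrA -xtn -ep (mulrA x) xtn.
  rewrite [t' ^+ p.+1]exprSr !mulrA (sq _ _ c' e') -!mulrA (mulrA t') -xt.
  by rewrite !mulrA.
by rewrite xs -sx.
Qed.

Section DrazinSwap.
Variable K : pzRingType.
Implicit Types t s a b : K.

Lemma is_drazin_inverse_sqr t s :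
  is_drazin_inverse t s -> is_drazin_inverse (t ^+ 2) (s ^+ 2).
Proof.
move=> [/commutator_eq0 c e [p [p0 ep]]]; split.
- by apply/commutator_eq0/commrX/commr_sym/commrX/commr_sym.
- by rewrite -exprMn_comm ?e//; apply/commr_sym/commrX/commr_sym.
- exists p; split=> //; rewrite -!exprM mulnC [(2 * p)%N]mulnC !exprM.
  rewrite -exprMn_comm ?ep//.
  exact/commr_sym/commrX.
Qed.

(** The two relations make [a] commute with [t ^+ 2], hence with its Drazin inverse [s ^+ 2]; then
    [s = s ^+ 2 * t] brings in [b]. *)
Lemma drazin_swap t s a b : is_drazin_inverse t s ->
  a * t = t * b -> b * t = t * a -> a * s = s * b.
Proof.
move=> ts ab ba; have ts2 := is_drazin_inverse_sqr ts.
have a2 : a * s ^+ 2 = s ^+ 2 * a.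
  apply: (drazin_intertwine ts2 ts2).
  by rewrite expr2 mulrA ab -!mulrA ba.
case: ts => _ e _.
by rewrite -[in LHS]e mulrA a2 -mulrA ab mulrA e.
Qed.

(* [q := 1 - t * s] projects onto the part where [t] is nilpotent; the second
   equation makes the off-diagonal blocks of [a] and [b] equal, and then the
   first one makes these blocks intertwine an invertible and a nilpotent
   element, so that they vanish. *)
Lemma drazin_swap_sub t s a b : is_drazin_inverse t s ->
  a * t = t * b -> (a - b) * s = s * (b - a) -> b * s = s * a /\ a * s = s * b.
Proof.
move=> [/commutator_eq0 c e [n [n0 en]]] ab abs.
have [p pE] : exists p, p = t * s by exists (t * s).
have [q qE] : exists q, q = 1 - p by exists (1 - p).
have ps : p * s = s by rewrite pE -c -mulrA -c mulrA -expr2 e.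
have sp : s * p = s by rewrite pE -c mulrA -expr2 e.
have pt : p * t = t * p by rewrite pE -mulrA c.
have pp : p * p = p by rewrite {1}pE -mulrA sp.
have qs : q * s = 0 by rewrite qE mulrBl mul1r ps subrr.
have sq : s * q = 0 by rewrite qE mulrBr mulr1 sp subrr.
have qp : q * p = 0 by rewrite qE mulrBl mul1r pp subrr.
have pq : p * q = 0 by rewrite qE mulrBr mulr1 pp subrr.
have qt : q * t = t * q by rewrite qE mulrBl mulrBr mul1r mulr1 pt.
have tnp : t ^+ n * p = t ^+ n by rewrite pE mulrA -exprSr en.
have tnq : t ^+ n * q = 0 by rewrite qE mulrBr mulr1 tnp subrr.
have qtn : q * t ^+ n = 0.
  by rewrite -tnq; apply/commrX.
(* Positivity of [n] matters: [p ^+ 0] is [1]. *)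
have pX : p ^+ n = p.
  by case: (n) n0 => // k _; elim: k => // k IH; rewrite exprS IH.
have tsn : t ^+ n * s ^+ n = p by rewrite -exprMn_comm -?pE ?pX//; exact/commr_sym.
have stn : s ^+ n * t ^+ n = p by rewrite -exprMn_comm// c -pE pX.
have qap : q * a * p = q * b * p.
  apply/eqP; rewrite -subr_eq0 -mulrBl -mulrBr pE -c mulrA -(mulrA q) abs.
  by rewrite mulrA qs !mul0r.
have paq : p * a * q = p * b * q.
  apply/eqP; rewrite -subr_eq0 -mulrBl -mulrBr pE -!mulrA (mulrA s).
  by rewrite -[a - b]opprB mulrN -abs mulNr -mulrA sq mulr0 oppr0 mulr0.
(* This block commutes with [t], so [t ^+ n] can be moved to its right, where [q] kills it; but
   [s ^+ n * t ^+ n = p] fixes the block. *)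
have paq0 : p * a * q = 0.
  have y : GRing.comm (p * a * q) t.
    by rewrite /GRing.comm -mulrA qt mulrA -(mulrA p) ab mulrA pt paq !mulrA.
  have yn : s ^+ n * (t ^+ n * (p * a * q)) = 0.
    by rewrite -(commrX n y) -(mulrA _ q) qtn !mulr0.
  by move: yn; rewrite mulrA stn !mulrA pp.
have qap0 : q * a * p = 0.
  have y : GRing.comm (q * a * p) t.
    rewrite /GRing.comm -mulrA pt (mulrA (q * a)) -(mulrA q) ab (mulrA q).
    by rewrite qt qap !mulrA.
  have yn : q * a * p * t ^+ n * s ^+ n = 0.
    by rewrite (commrX n y) !mulrA tnq !mul0r.
  by move: yn; rewrite -mulrA tsn -mulrA pp.
have comm_p u : p * u * q = 0 -> q * u * p = 0 -> u * p = p * u.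
  rewrite qE mulrBr mulr1 !mulrBl mul1r => /eqP + /eqP.
  by rewrite !subr_eq0 => /eqP pu /eqP ->.
have ap := comm_p a paq0 qap0.
have bp : b * p = p * b by apply: comm_p; rewrite -?paq -?qap.
(* Since [a] and [b] commute with [p = s * t], [b * s = s * (t * b) * s = s * a * p = s * a]. *)
have bs : b * s = s * a.
  rewrite -[in LHS]ps mulrA bp {1}pE -c -!mulrA (mulrA t) -ab -mulrA -pE ap.
  by rewrite mulrA sp.
split=> //; move: abs; rewrite mulrBl mulrBr bs.
by move/addIr.
Qed.

End DrazinSwap.

(** * Recovering the two relations from their sum and difference *)

(** The factor 2 remains because [V] may have 2-torsion; [bop_mulr2n_inj] cancels it for
    operators. *)
Lemma double_swap (V : zmodType) (a b c d : V) :
  a + b = c + d -> a - b = d - c -> a *+ 2 = d *+ 2 /\ b *+ 2 = c *+ 2.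
Proof.
have dbl (u v : V) : u *+ 2 = (u + v) + (u - v).
  by rewrite addrACA subrr addr0 mulr2n.
move=> E E'; split; first by rewrite (dbl a b) E E' (dbl d c) (addrC c).
by rewrite (dbl b a) (addrC b) E -opprB E' opprB -dbl.
Qed.

Theorem theorem2p8 (R : realType) (H : hilbertType R)
    (infinite_dim : ~ finite_dim H) (A B T : bop H)
    (AT_TB : A * T = T * B) (DN_T : DN T)
    (BT_or_drazin : B * T = T * A
                 \/ (A - B) * drazin T = drazin T * (B - A)) :
  adjoint (drazin T) * A = B * adjoint (drazin T)
  /\ adjoint (drazin T) * B = A * adjoint (drazin T).
Proof.
have [dT /commutator_eq0 cST'] := DN_T.
have TS := drazinP dT; set S := drazin T in BT_or_drazin TS cST' *.
have adj := @is_adjoint_adjoint R H.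
(* Adjoints are taken in the commutation of [S] with [adjoint T]; [drazin_intertwine] with [x] equal
   to [adjoint S] then gives normality of [S]. *)
have cS'T : adjoint S * T = T * adjoint S.
  have := is_adjointM (adj S) (is_adjoint_sym (adj T)).
  rewrite cST' => /adjoint_eq <-; apply/esym/adjoint_eq.
  exact: is_adjointM (is_adjoint_sym (adj T)) (adj S).
have cS : GRing.comm S (adjoint S).
  exact/esym/(drazin_intertwine TS TS).
have [SA SB] : B * S = S * A /\ A * S = S * B.
  case: BT_or_drazin => [BT|]; last exact (drazin_swap_sub TS AT_TB).
  exact (conj (drazin_swap TS BT AT_TB) (drazin_swap TS AT_TB BT)).
have FD : adjoint S * (A + B) = (A + B) * adjoint S.
  apply: (fuglede_putnam (adj S) cS (adj S) cS).
  by rewrite mulrDl mulrDr SA SB addrC.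
(* Fuglede-Putnam for the normal pair [S] and [- S]. *)
have FB : adjoint S * (A - B) = (A - B) * - adjoint S.
  apply: (fuglede_putnam (adj S) cS (is_adjointN (adj S))).
    exact/commrN/commr_sym/commrN/commr_sym.
  by rewrite mulrN mulrBl mulrBr SA SB opprB.
move: FD FB; rewrite mulrDr mulrBr mulrDl mulrN mulrBl opprB => FD FB.
have [? ?] := double_swap FD FB.
by split; apply: bop_mulr2n_inj.
Qed.
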